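(* Let $Y_1,\dots,Y_n$ be i.i.d. real random variables with mean $m$ and finite variance $v$. Assume that $v \le v_0$ and $|m-\theta_0| \le \delta_0$, where $v_0>0$, $\theta_0\in\mathbb{R}$ and $\delta_0\ge 0$ are known (non random) constants. Let $k\ge 1$, let $x_2,\dots,x_k>0$ and $\epsilon_1,\dots,\epsilon_k\in(0,1)$ be constants, and let $U_2,\dots,U_k$ be uniform random variables on $(-1,1)$, independent of each other and of everything else. Define $$\delta_1=\sqrt{\frac{2(v_0+\delta_0^2)\log(\epsilon_1^{-1})}{n}},\qquad \alpha_1=\sqrt{\frac{2\log(\epsilon_1^{-1})}{n(v_0+\delta_0^2)}},\qquad \widetilde\theta_1=\widehat\theta_{\alpha_1}(\theta_0),$$ and for $i=2,\dots,k$, $$\gamma_i=\log(1+x_i^{-1}),\qquad \delta_i=\sqrt{\frac{2\bigl[v_0+(1+x_i)^2\delta_{i-1}^2\bigr]\bigl[\log(\epsilon_i^{-1})+\gamma_i\bigr]}{n}},$$ $$\alpha_i=\sqrt{\frac{2\bigl[\log(\epsilon_i^{-1})+\gamma_i\bigr]}{n\bigl[v_0+(1+x_i)^2\delta_{i-1}^2\bigr]}},\qquad \widetilde\theta_i=\widehat\theta_{\alpha_i}\bigl(\widetilde\theta_{i-1}+x_i\delta_{i-1}U_i\bigr).$$ Then with probability at least $1-2\sum_{i=1}^k\epsilon_i$, $$|m-\widetilde\theta_k|\le\delta_k.$$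
   Context: For $\alpha>0$ and $\theta\in\mathbb{R}$, the thresholded estimator based on the sample $Y_1,\dots,Y_n$ is $$\widehat\theta_\alpha(\theta)=\theta+\frac{1}{n\alpha}\sum_{i=1}^nT\bigl[\alpha(Y_i-\theta)\bigr],\qquad T(x)=\frac12\log\left(\frac{1+x+\frac{x^2}{2}}{1-x+\frac{x^2}{2}}\right).$$ The same sample is used at every step of the iteration. *)

(* Defs.v *)
From HB Require Import structures.
From mathcomp Require Import all_boot all_order all_algebra.
From mathcomp Require Import all_classical all_reals all_analysis.
Set Implicit Arguments.
Unset Strict Implicit.
Unset Printing Implicit Defensive.
Import Order.TTheory GRing.Theory Num.Theory.
Import numFieldNormedType.Exports.
Local Open Scope classical_set_scope.
Local Open Scope ring_scope.

Definition mutually_independent d (Omega : measurableType d) (R : realType)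
    (P : probability Omega R) (I : finType) (X : I -> {RV P >-> R}) : Prop :=
  forall (J : {set I}) (B : I -> set R),
    (forall i, i \in J -> measurable (B i)) ->
    P [set w | forall i, i \in J -> B i (X i w)]
    = (\prod_(i in J) P (X i @^-1` B i))%E.

Definition identically_distributed d (Omega : measurableType d) (R : realType)
    (P : probability Omega R) (I : Type) (X : I -> {RV P >-> R}) : Prop :=
  forall (i j : I) (A : set R), measurable A ->
    distribution P (X i) A = distribution P (X j) A.

Lemma ltrN11_num (R : realType) : (-1 : R) < 1.
Proof. exact: (@gtrN R 1 ltr01). Qed.

(* [uniform_prob] is normalised Lebesgue measure on the closed interval
   [-1, 1]; the endpoints are null, so this is the law on (-1, 1). *)
Definition uniform_on_m1_1 d (Omega : measurableType d) (R : realType)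
    (P : probability Omega R) (U : {RV P >-> R}) : Prop :=
  forall A : set R, measurable A ->
    distribution P U A = uniform_prob (ltrN11_num R) A.

(* Y_1, .., Y_n followed by U_2, .., U_k: the index j < k - 1 stands for
   U_(j + 2). *)
Definition sample_and_noise (RV : Type) (n k : nat) (Y : 'I_n -> RV)
    (U : nat -> RV) (s : 'I_n + 'I_k.-1) : RV :=
  match s with
  | inl i => Y i
  | inr j => U j.+2
  end.

Section Estimator.
Context {R : realType}.

Definition threshold (x : R) : R :=
  2^-1 * ln ((1 + x + x ^+ 2 / 2) / (1 - x + x ^+ 2 / 2)).

Definition thresholded_estimator (n : nat) (y : 'I_n -> R) (alpha theta : R)
    : R :=
  theta + (n%:R * alpha)^-1 * \sum_(i < n) threshold (alpha * (y i - theta)).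

Variables (n : nat) (v0 theta0 delta0 : R) (x eps : nat -> R).

Definition gamma (i : nat) : R := ln (1 + (x i)^-1).

(* The value at 0 is the initial radius delta0, so delta 1 is the first
   computed one. *)
Fixpoint delta (i : nat) : R :=
  match i with
  | 0 => delta0
  | j.+1 =>
      if j is 0
      then Num.sqrt (2 * (v0 + delta0 ^+ 2) * ln (eps 1)^-1 / n%:R)
      else Num.sqrt (2 * (v0 + (1 + x i) ^+ 2 * delta j ^+ 2)
                       * (ln (eps i)^-1 + gamma i) / n%:R)
  end.

(* Only used for i >= 1. *)
Definition alpha (i : nat) : R :=
  if (i <= 1)%N
  then Num.sqrt (2 * ln (eps 1)^-1 / (n%:R * (v0 + delta0 ^+ 2)))
  else Num.sqrt (2 * (ln (eps i)^-1 + gamma i)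
                   / (n%:R * (v0 + (1 + x i) ^+ 2 * delta i.-1 ^+ 2))).

(* The iterates as a function of the realised sample y and noises u; the value
   at 0 is the deterministic starting point theta0. *)
Fixpoint theta_iter (y : 'I_n -> R) (u : nat -> R) (i : nat) : R :=
  match i with
  | 0 => theta0
  | j.+1 =>
      if j is 0
      then thresholded_estimator y (alpha 1) theta0
      else thresholded_estimator y (alpha i)
             (theta_iter y u j + x i * delta j * u i)
  end.

End Estimator.

(* Main.v *)
Require Import Defs.
From HB Require Import structures.
From mathcomp Require Import all_boot all_order all_algebra.
From mathcomp Require Import all_classical all_reals all_analysis.
From mathcomp Require Import measurable_realfun ring lra.
Import Order.TTheory GRing.Theory Num.Theory.
Import numFieldNormedType.Exports.
Local Open Scope classical_set_scope.
Local Open Scope ring_scope.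

Set Implicit Arguments.
Unset Strict Implicit.
Unset Printing Implicit Defensive.

(** The proof is a PAC-Bayesian chaining of deviation bounds.

    Fixed centre. Since [exp (T x) <= 1 + x + x^2/2] and [T] is odd, for a
    deterministic centre [th] with [|m - th| <= b] independence gives
    [E exp (sum_i T (s (Y_i - th)))
      <= exp (n (s (m - th) + s^2 (v + (m - th)^2) / 2))] for every real [s].
    Chernoff's inequality at [s = alpha] and [s = - alpha], with [alpha] tuned
    to a level [L], shows that the estimator misses [m] by more than
    [sqrt (2 (v0 + b^2) L / n)] with probability at most [2 exp (- L)]; this is
    [estimator_deviation].

    Random centre. At a later step the centre depends on the sample that is
    being used again, so the bound above does not apply to it. The uniform
    noise repairs this. On the event that the previous iterate [Z] is within
    [rho] of [m], the centre [Z + r U] has, conditionally on everything but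
    [U], a density at most [1 / (2 r)] on the fixed interval of radius
    [rho + r] around [m]. Integrating the fixed-centre bound [p] over that
    interval, which has length [2 (rho + r)], gives the probability bound
    [(1 + rho / r) p]; this is [uniform_smoothing]. With [r = x rho] the loss
    is the factor [1 + 1 / x = exp gamma], which the extra [gamma] in the
    definitions of [delta] and [alpha] absorbs.

    A union bound over the steps, each costing [2 eps i], concludes.

    Conditioning on everything but [U] is expressed without conditional
    expectations: the other variables generate a sub-sigma-algebra, and
    independence says that the joint law of the identity map into the
    coarser space and of [U] is a product measure ([integral_sigma_pair]).
    The same identity factors the expectation of a product of functions of
    the [Y_i]. *)

(** * The thresholding function *)

Section Threshold.
Context {R : realType}.
Implicit Types x : R.

Lemma quadratic_exp_gt0 x : 0 < 1 + x + x ^+ 2 / 2.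
Proof.
have -> : 1 + x + x ^+ 2 / 2 = 2^-1 + 2^-1 * (1 + x) ^+ 2 by field.
have : 0 <= (1 + x) ^+ 2 by exact: sqr_ge0.
lra.
Qed.

Lemma quadratic_expN_gt0 x : 0 < 1 - x + x ^+ 2 / 2.
Proof. by have := quadratic_exp_gt0 (- x); rewrite sqrrN. Qed.

Lemma thresholdE x :
  threshold x = 2^-1 * (ln (1 + x + x ^+ 2 / 2) - ln (1 - x + x ^+ 2 / 2)).
Proof.
by rewrite /threshold ln_div// posrE ?quadratic_exp_gt0 ?quadratic_expN_gt0.
Qed.

Lemma thresholdN x : threshold (- x) = - threshold x.
Proof. by rewrite !thresholdE sqrrN opprK; field. Qed.

(** The product (1 + x + x^2/2)(1 - x + x^2/2) equals 1 + x^4/4 >= 1, so the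
    second factor of the quotient defining [threshold] is at least the inverse
    of the first one. *)
Lemma expR_threshold_le x : expR (threshold x) <= 1 + x + x ^+ 2 / 2.
Proof.
have p0 := quadratic_exp_gt0 x; have q0 := quadratic_expN_gt0 x.
rewrite -[leRHS]lnK ?posrE// ler_expR thresholdE.
have : 0 <= ln ((1 + x + x ^+ 2 / 2) * (1 - x + x ^+ 2 / 2)).
  apply: ln_ge0.
  have -> : (1 + x + x ^+ 2 / 2) * (1 - x + x ^+ 2 / 2)
            = 1 + (x ^+ 2) ^+ 2 / 4 by field.
  by have := sqr_ge0 (x ^+ 2); lra.
rewrite lnM ?posrE//; lra.
Qed.

Lemma measurable_threshold : measurable_fun [set: R] (@threshold R).
Proof.
rewrite (funext thresholdE).
have m2 : measurable_fun [set: R] (fun x : R => x ^+ 2 / 2).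
  by apply: measurable_funM => //; exact: measurable_funX.
apply: measurable_funM => //; apply: measurable_funB.
  apply: measurableT_comp; first exact: measurable_ln.
  by apply: measurable_funD => //; apply: measurable_funD.
apply: measurableT_comp; first exact: measurable_ln.
by apply: measurable_funD => //; apply: measurable_funB.
Qed.

Lemma measurable_threshold_scaled d (T : measurableType d) (a : R)
    (y th : T -> R) : measurable_fun setT y -> measurable_fun setT th ->
  measurable_fun setT (fun w => threshold (a * (y w - th w))).
Proof.
move=> my mth; apply: measurableT_comp; first exact: measurable_threshold.
by apply: measurable_funM => //; exact: measurable_funB.
Qed.

Lemma measurable_thresholded_estimator d (T : measurableType d) (n : nat)
    (y : 'I_n -> T -> R) (a : R) (th : T -> R) :
  (forall i, measurable_fun setT (y i)) -> measurable_fun setT th ->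
  measurable_fun setT (fun w => thresholded_estimator (y ^~ w) a (th w)).
Proof.
move=> my mth; apply: measurable_funD => //; apply: measurable_funM => //.
by apply: measurable_sum => i; exact: measurable_threshold_scaled.
Qed.

Lemma measurable_theta_iter d (T : measurableType d) (n : nat)
    (v0 theta0 delta0 : R) (x eps : nat -> R)
    (y : 'I_n -> T -> R) (u : nat -> T -> R) (k : nat) :
  (forall i, measurable_fun setT (y i)) ->
  (forall i, (2 <= i <= k)%N -> measurable_fun setT (u i)) ->
  measurable_fun setT
    (fun w => theta_iter v0 theta0 delta0 x eps (y ^~ w) (u ^~ w) k).
Proof.
move=> my; elim: k => [|k IHk] mu; first exact: measurable_cst.
have {}IHk : measurable_fun setT
    (fun w => theta_iter v0 theta0 delta0 x eps (y ^~ w) (u ^~ w) k).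
  by apply: IHk => i /andP[i2 ik]; apply: mu; rewrite i2 leqW.
case: k IHk mu => [|k] IHk mu /=.
  exact: measurable_thresholded_estimator.
apply: measurable_thresholded_estimator => //; apply: measurable_funD => //.
by apply: measurable_funM => //; apply: mu; rewrite leqnn.
Qed.

End Threshold.

(** * Independence from a sub-sigma-algebra *)

Section IndependenceOfSigmaAlgebra.
Context d (Omega : measurableType d) (R : realType) (P : probability Omega R).
Variables (X : {RV P >-> R}) (C : set (set Omega)).
Hypotheses (mC : C `<=` measurable) (CI : setI_closed C) (CT : C setT).
Hypothesis C_indep : forall A B, C A -> measurable B ->
  P (A `&` X @^-1` B) = (P A * P (X @^-1` B))%E.

(** Both sides are finite measures in [A] that agree on the pi-system [C]. *)
Lemma sigma_independent A (B : set R) : <<s C >> A -> measurable B ->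
  P (A `&` X @^-1` B) = (P A * P (X @^-1` B))%E.
Proof.
move=> sA mB; have mXB : measurable (X @^-1` B) by exact: measurable_funPTI.
have PXB : P (X @^-1` B) \is a fin_num by exact: fin_num_measure.
have r0 : 0 <= fine (P (X @^-1` B)) by exact: fine_ge0.
transitivity (mscale (NngNum r0) P A); last first.
  by rewrite /mscale/= fineK// muleC.
rewrite -/(mrestr P mXB A).
apply: (g_sigma_algebra_measure_unique C mC (fun=> setT)) => //=.
- by rewrite bigcup_const//; exists 0%N.
- by move=> D CD; rewrite /mrestr C_indep// /mscale/= fineK// muleC.
- move=> _; rewrite /mrestr setTI ltey_eq; apply/orP; left.
  exact: fin_num_measure.
Qed.

Local Notation OmegaC := (g_sigma_algebraType C).

Lemma measurable_id_sigma : measurable_fun setT (id : Omega -> OmegaC).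
Proof.
move=> _ A mA; rewrite setTI preimage_id.
exact: (smallest_sub (@sigma_algebra_measurable _ Omega) mC).
Qed.

Lemma measurable_sigma_pair :
  measurable_fun setT ((fun w => (w, X w)) : Omega -> OmegaC * R).
Proof.
by apply: measurable_fun_pair => //; exact: measurable_id_sigma.
Qed.

(** The map [w |-> (w, X w)] sends [P] to the product of the restriction of
    [P] to the sigma-algebra of [C] with the law of [X], because the two
    measures agree on rectangles. This replaces conditioning on the
    sigma-algebra of [C]. *)
Lemma integral_sigma_pair (h : OmegaC * R -> \bar R) :
  measurable_fun setT h -> (forall z, 0 <= h z)%E ->
  (\int[P]_w h (w, X w) = \int[P]_w \int[distribution P X]_x h (w, x))%E.
Proof.
move=> mh h0.
pose idC : {mfun Omega >-> OmegaC} := mfun_Sub (mem_set measurable_id_sigma).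
pose pr : {mfun Omega >-> (OmegaC * R)%type} :=
  mfun_Sub (mem_set measurable_sigma_pair).
have prE A : measurable A ->
    (distribution P idC \x distribution P X)%E A = distribution P pr A.
  move=> mA0; apply: product_measure_unique mA0 => {A} A B mA mB.
  rewrite /distribution/= /pushforward /= -sigma_independent//.
transitivity (\int[distribution P pr]_z h z)%E.
  by rewrite ge0_integral_distribution.
transitivity (\int[distribution P idC \x distribution P X]_z h z)%E.
  by apply: eq_measure_integral => A mA _; exact/esym/prE.
rewrite fubini_tonelli1//.
rewrite ge0_integral_distribution//.
  exact: measurable_fun_fubini_tonelli_F.
by move=> w; exact: integral_ge0.
Qed.

End IndependenceOfSigmaAlgebra.

(** * Independence within a finite family *)

Section CylinderEvents.
Context d (Omega : measurableType d) (R : realType) (P : probability Omega R).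
Context (I : finType) (X : I -> {RV P >-> R}).
Hypothesis indepX : mutually_independent X.
Implicit Types (J : {set I}) (B : I -> set R).

(** A pi-system generating the sigma-algebra of the [X i] with [i \in J].  The
    sets [B i] are taken for all [i], so that an intersection of two events is
    computed coordinatewise. *)
Definition cylinder_events J : set (set Omega) :=
  [set A | exists2 B, (forall i, measurable (B i)) &
           A = [set w | forall i, i \in J -> B i (X i w)]].

Lemma cylinder_events_measurable J : cylinder_events J `<=` measurable.
Proof.
move=> _ [B mB ->].
rewrite [X in measurable X](_ : _ =
    \bigcap_(i in [set i | i \in J]) (X i @^-1` B i)).
  by apply: fin_bigcap_measurable => // i _; exact: measurable_funPTI.
by [].
Qed.

Lemma cylinder_eventsI J : setI_closed (cylinder_events J).
Proof.
move=> _ _ [A mA ->] [B mB ->].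
exists (fun i => A i `&` B i); first by move=> i; exact: measurableI.
apply/seteqP; split => [w [/= Aw Bw] i iJ|w /= ABw].
  by split; [exact: Aw|exact: Bw].
by split=> i /ABw[].
Qed.

Lemma cylinder_eventsT J : cylinder_events J setT.
Proof. by exists (fun=> setT) => //; apply/seteqP; split. Qed.

Lemma measurable_cylinder J i : i \in J ->
  measurable_fun setT (X i : g_sigma_algebraType (cylinder_events J) -> R).
Proof.
move=> iJ _ B mB; rewrite setTI; apply: sub_sigma_algebra.
exists (fun j => if j == i then B else setT).
  by move=> j; case: ifP.
apply/seteqP; split => [w Bw j _|w /(_ _ iJ)/=].
  by case: eqP => [->|].
by rewrite eqxx.
Qed.

Lemma cylinder_events_indep J s : s \notin J ->
  forall A (B : set R), cylinder_events J A -> measurable B ->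
  P (A `&` X s @^-1` B) = (P A * P (X s @^-1` B))%E.
Proof.
move=> sJ _ D [B mB ->] mD.
pose B' i := if i == s then D else B i.
have mB' i : measurable (B' i) by rewrite /B'; case: ifP.
rewrite (_ : _ `&` _ = [set w | forall i, i \in (s |: J) -> B' i (X i w)]).
  rewrite indepX//= big_setU1//= {1}/B' eqxx muleC.
  congr (_ * _)%E; rewrite indepX//; apply: eq_bigr => i iJ.
  by rewrite /B'; case: eqP iJ sJ => // -> ->.
apply/seteqP; split => [w [/= Bw Dw] i|w /= Bw].
  rewrite !inE /B'; case: eqP => [->//|_] /= iJ; exact: Bw.
split; last by have := Bw s; rewrite !inE eqxx /B' eqxx; exact.
move=> i iJ; have := Bw i; rewrite !inE iJ orbT /B'.
by case: eqP iJ sJ => [-> ->//|_ _ _]; exact.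
Qed.

Lemma integral_cylinder_pair J s : s \notin J ->
  forall h : g_sigma_algebraType (cylinder_events J) * R -> \bar R,
  measurable_fun setT h -> (forall z, 0 <= h z)%E ->
  (\int[P]_w h (w, X s w) = \int[P]_w \int[distribution P (X s)]_x h (w, x))%E.
Proof.
move=> sJ h; apply: integral_sigma_pair.
- exact: cylinder_events_measurable.
- exact: cylinder_eventsI.
- exact: cylinder_eventsT.
- exact: cylinder_events_indep.
Qed.

(** Induction on [J]: removing [s] leaves a function that is measurable for the
    sigma-algebra of the other variables, hence independent of [X s]. *)
Lemma integral_prod_indep J (f : I -> R -> R) :
  (forall i, measurable_fun setT (f i)) -> (forall i x, 0 <= f i x) ->
  (\int[P]_w (\prod_(i in J) f i (X i w))%:E
   = \prod_(i in J) \int[P]_w (f i (X i w))%:E)%E.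
Proof.
move=> mf f0; have [n] := ubnP #|J|; elim: n J => // n IHn J Jn.
have [->|[s sJ]] := set_0Vmem J.
  rewrite big_set0; under eq_integral do rewrite big_set0.
  rewrite integral_cst//= mul1e; exact: probability_setT.
rewrite (big_setD1 s)//=; under eq_integral do rewrite (big_setD1 s)//=.
set K := J :\ s in IHn *.
have sK : s \notin K by rewrite !inE eqxx.
have Kn : (#|K| < n)%N by move: Jn; rewrite (cardsD1 s) sJ.
rewrite -IHn//.
pose g (w : Omega) : R := \prod_(i in K) f i (X i w).
have g0 w : 0 <= g w by exact: prodr_ge0.
have mg : measurable_fun setT
    (g : g_sigma_algebraType (cylinder_events K) -> R).
  rewrite /g; under eq_fun do rewrite -big_enum.
  apply: measurable_prod => i; rewrite mem_enum => iK.
  by apply: measurableT_comp => //; exact: measurable_cylinder.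
have mgO : measurable_fun [set: Omega] g.
  apply: (measurable_comp measurableT _ mg) => //=.
  exact: measurable_id_sigma (@cylinder_events_measurable K).
rewrite (integral_cylinder_pair sK
  (h := fun z => (f s z.2 * g z.1)%:E)); last 2 first.
- apply/measurable_EFinP; apply: measurable_funM.
    exact: measurableT_comp.
  exact: (measurableT_comp mg).
- by move=> z; rewrite lee_fin mulr_ge0.
transitivity (\int[P]_w ((\int[P]_w (f s (X s w))%:E) * (g w)%:E))%E.
  apply: eq_integral => w _ /=.
  rewrite -(@ge0_integral_distribution _ _ _ _ _ P (X s)
    (EFin \o f s)); last 2 first.
  - exact/measurable_EFinP.
  - by move=> x; rewrite lee_fin.
  under eq_integral do rewrite EFinM.
  rewrite ge0_integralZr//; first exact/measurable_EFinP.
  - by move=> x _; rewrite lee_fin.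
  - by rewrite lee_fin.
rewrite ge0_integralZl//; first exact/measurable_EFinP.
- by move=> x _; rewrite lee_fin.
- by apply: integral_ge0 => x _; rewrite lee_fin.
Qed.

End CylinderEvents.

(** * Deviation of the estimator at a fixed centre *)

Section FixedCentre.
Context d (Omega : measurableType d) (R : realType) (P : probability Omega R).
Context (n : nat) (Y : 'I_n -> {RV P >-> R}) (m v : R).
Hypothesis Y_indep : mutually_independent Y.
Hypothesis Y_L2 : forall i, (Y i : Omega -> R) \in Lfun P 2%:E.
Hypothesis Y_mean : forall i, ('E_P[Y i] = m%:E)%E.
Hypothesis Y_var : forall i, ('V_P[Y i] = v%:E)%E.

Lemma second_moment i : (\int[P]_w (Y i w ^+ 2)%:E = (v + m ^+ 2)%:E)%E.
Proof.
have := varianceE (Y_L2 i); rewrite Y_var Y_mean.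
rewrite (_ : 'E_P[_] = \int[P]_w (Y i w ^+ 2)%:E)%E; last first.
  by rewrite unlock.
case: (\int[P]_w _)%E => [r| |] //=.
by rewrite -EFinD => -[->]; congr EFin; ring.
Qed.

Lemma integral_quadratic i (c0 c1 c2 : R) :
  (\int[P]_w (c0 + c1 * Y i w + c2 * Y i w ^+ 2)%:E
   = (c0 + c1 * m + c2 * (v + m ^+ 2))%:E)%E.
Proof.
have I1 : P.-integrable setT (EFin \o Y i).
  apply/Lfun1_integrable; apply: Lfun_subset12 => //.
  exact: fin_num_measure.
have I2 : P.-integrable setT (fun w => (Y i w ^+ 2)%:E).
  have /Lfun1_integrable := Lfun2_mul_Lfun1 (Y_L2 i) (Y_L2 i).
  by apply: eq_integrable => // w _; rewrite /= expr2.
have I0 : P.-integrable setT (EFin \o cst c0).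
  exact: finite_measure_integrable_cst.
have J1 := integrableZl measurableT c1 I1.
have J2 := integrableZl measurableT c2 I2.
rewrite (eq_integral
  (fun w => ((EFin \o cst c0) w + c1%:E * (EFin \o Y i) w)
            + c2%:E * (Y i w ^+ 2)%:E)%E); last first.
  by move=> w _; rewrite /= !EFinD !EFinM.
rewrite integralD//=; last exact: integrableD.
rewrite integralD//= integralZl// integralZl//.
rewrite second_moment -expectation_def Y_mean.
rewrite integral_cst//= (_ : P setT = 1%E) ?mule1//.
exact: probability_setT.
Qed.

Lemma integral_expR_threshold_le i (a th : R) :
  (\int[P]_w (expR (threshold (a * (Y i w - th))))%:E
   <= (expR (a * (m - th) + a ^+ 2 / 2 * (v + (m - th) ^+ 2)))%:E)%E.
Proof.
pose c0 := 1 - a * th + a ^+ 2 * th ^+ 2 / 2.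
pose c1 := a - a ^+ 2 * th; pose c2 := a ^+ 2 / 2.
have qE y : 1 + a * (y - th) + (a * (y - th)) ^+ 2 / 2
            = c0 + c1 * y + c2 * y ^+ 2.
  by rewrite /c0 /c1 /c2; field.
apply: (@le_trans _ _ (\int[P]_w (c0 + c1 * Y i w + c2 * Y i w ^+ 2)%:E)%E).
  apply: ge0_le_integral => //.
  - apply/measurable_EFinP; apply: measurableT_comp => //.
    exact: measurable_threshold_scaled.
  - apply/measurable_EFinP; apply: measurable_funD.
      by apply: measurable_funD => //; exact: measurable_funM.
    by apply: measurable_funM => //; exact: measurable_funX.
  - by move=> w _; rewrite lee_fin -qE expR_threshold_le.
rewrite integral_quadratic lee_fin; apply: le_trans (expR_ge1Dx _).
by rewrite le_eqVlt; apply/orP; left; apply/eqP; rewrite /c0 /c1 /c2; field.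
Qed.

(** Chernoff's inequality; [a] may be negative, which gives the lower tail of
    the sum since [threshold] is odd. *)
Lemma threshold_sum_tail (a th L : R) :
  (P [set w | (n%:R * (a * (m - th) + a ^+ 2 / 2 * (v + (m - th) ^+ 2)) + L
               <= \sum_(i < n) threshold (a * (Y i w - th)))%R]
   <= (expR (- L))%:E)%E.
Proof.
set c := a * (m - th) + _.
pose S (w : Omega) : R := \sum_(i < n) threshold (a * (Y i w - th)).
have mS : measurable_fun setT S.
  by apply: measurable_sum => i; exact: measurable_threshold_scaled.
have := chernoff (mfun_Sub (mem_set mS) : {RV P >-> R}) (n%:R * c + L) ltr01.
move=> /le_trans; apply; rewrite /mmt_gen_fun unlock /=.
apply: (@le_trans _ _ ((expR (n%:R * c))%:E * (expR (- (n%:R * c + L)))%:E)%E).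
  2: by rewrite -EFinM -expRD opprD addNKr.
rewrite mul1r; apply: lee_pmul => //.
- by apply: integral_ge0 => w _; rewrite lee_fin expR_ge0.
rewrite (eq_integral (fun w => (\prod_(i in [set: 'I_n]%SET)
   expR (threshold (a * (Y i w - th))))%:E)); last first.
  move=> w _; rewrite /S /= mulr1 expR_sum; congr EFin.
  by apply: eq_bigl => i; rewrite inE.
rewrite (integral_prod_indep Y_indep _
  (f := fun _ y => expR (threshold (a * (y - th))))); last 2 first.
- move=> i; apply: measurableT_comp => //.
  exact: measurable_threshold_scaled.
- by move=> i x; exact: expR_ge0.
have -> : expR (n%:R * c) = \prod_(i in [set: 'I_n]%SET) expR c.
  by rewrite prodr_const cardsT card_ord expRM_natl.
rewrite -prodEFin.
(* nonnegativity is carried along because multiplying bounds needs it *)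
apply: proj2; apply/andP.
apply: (big_ind2 (fun x y : \bar R => 0 <= x <= y)%E).
- by rewrite lee01 lexx.
- move=> x1 x2 y1 y2 /andP[x1_ge0 x12] /andP[y1_ge0 y12].
  by rewrite mule_ge0//= lee_pmul.
- move=> i _; rewrite integral_expR_threshold_le andbT.
  by apply: integral_ge0 => w _; rewrite lee_fin expR_ge0.
Qed.

Variables (v0 b L : R).
Hypotheses (n_gt0 : (0 < n)%N) (v_le : v <= v0).
Hypotheses (v0_gt0 : 0 < v0) (L_gt0 : 0 < L).
Let D := v0 + b ^+ 2.

(** For a factor [a] the error is at most [a D / 2 + L / (n a)] outside the two
    tails of [threshold_sum_tail]; the chosen factor minimises this bound and
    makes both terms equal to half of the radius. *)
Lemma estimator_deviation (th : R) : `|m - th| <= b ->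
  (P [set w | (Num.sqrt (2 * D * L / n%:R) <
      `|m - thresholded_estimator (Y ^~ w)
              (Num.sqrt (2 * L / (n%:R * D))) th|)%R]
   <= (2 * expR (- L))%:E)%E.
Proof.
move=> thb; set r := Num.sqrt (2 * D * L / n%:R).
set a := Num.sqrt (2 * L / (n%:R * D)).
have n0 : (0 : R) < n%:R by rewrite ltr0n.
have D0 : 0 < D by rewrite /D ltr_pwDl// sqr_ge0.
have a2 : a ^+ 2 = 2 * L / (n%:R * D).
  by rewrite sqr_sqrtr// divr_ge0 ?mulr_ge0// ltW.
have a0 : 0 < a by rewrite sqrtr_gt0 divr_gt0 ?mulr_gt0.
(* 2 L is the level L plus the variance term n a^2 D / 2, also equal to L *)
have rE : n%:R * a * r = 2 * L.
  have -> : r = a * D.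
    have -> : r = Num.sqrt (2 * L / (n%:R * D) * D ^+ 2).
      by rewrite /r; congr Num.sqrt; field; rewrite !gt_eqF.
    by rewrite sqrtrM ?divr_ge0 ?mulr_ge0 ?ltW// sqrtr_sqr gtr0_norm.
  have -> : n%:R * a * (a * D) = n%:R * D * a ^+ 2 by ring.
  by rewrite a2; field; rewrite !gt_eqF.
have vD : v + (m - th) ^+ 2 <= D.
  rewrite /D lerD// -ler_sqrt ?sqr_ge0// ?sqrtr_sqr.
  by rewrite (le_trans thb)// ler_norm.
have nD : n%:R * (a ^+ 2 / 2 * (v + (m - th) ^+ 2)) <= L.
  have -> : L = n%:R * (a ^+ 2 / 2 * D).
    by rewrite a2; field; rewrite !gt_eqF.
  by rewrite ler_pM2l// ler_wpM2l// divr_ge0// sqr_ge0.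
pose tail s := [set w : Omega |
  n%:R * (s * (m - th) + s ^+ 2 / 2 * (v + (m - th) ^+ 2)) + L
  <= \sum_(i < n) threshold (s * (Y i w - th))].
have mtail s : measurable (tail s).
  rewrite -[X in measurable X]setTI; apply: measurable_fun_ler => //.
  by apply: measurable_sum => i; exact: measurable_threshold_scaled.
apply: (@le_trans _ _ (P (tail a `|` tail (- a)))).
  apply: le_measure; rewrite ?inE.
  - rewrite -[X in measurable X]setTI; apply: measurable_fun_ltr => //.
    apply: measurableT_comp => //; apply: measurable_funB => //.
    exact: measurable_thresholded_estimator.
  - exact: measurableU.
  - move=> w /=; rewrite /thresholded_estimator.
    set S := \sum_(i < n) _ => rlt.
    have SN : \sum_(i < n) threshold (- a * (Y i w - th)) = - S.
      by rewrite /S -sumrN; apply: eq_bigr => i _; rewrite mulNr thresholdN.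
    rewrite /tail /= SN -/S sqrrN.
    have na0 : 0 < n%:R * a by exact: mulr_gt0.
    have : 2 * L < `|n%:R * a * (m - th) - S|.
      rewrite (_ : _ - S = n%:R * a * (m - (th + (n%:R * a)^-1 * S))).
        by rewrite normrM gtr0_norm// -rE ltr_pM2l.
      by field; rewrite !gt_eqF.
    (* an estimate below the mean is a large value of the sum for - a *)
    rewrite ltr_normr => /orP[SL|SL]; [right|left]; lra.
rewrite (le_trans (measureU2 _ _ _))// mulrDl mul1r EFinD.
by apply: leeD; exact: threshold_sum_tail.
Qed.

End FixedCentre.

(** * Smoothing by a uniform noise *)

Section UniformSmoothing.
Context {R : realType}.
Local Notation mu := (@lebesgue_measure R).

Lemma measurable_affine (z r : R) :
  measurable_fun setT
    (fun u : measurableTypeR R => z + r * u : measurableTypeR R).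
Proof. by apply: measurable_funD => //; exact: measurable_funM. Qed.

Lemma lebesgue_measure_affine (z r : R) (A : set R) : 0 < r -> measurable A ->
  (r%:E * mu ((fun u : R => z + r * u)%R @^-1` A) = mu A)%E.
Proof.
move=> r0 mA.
pose f (u : measurableTypeR R) : measurableTypeR R := z + r * u.
pose nu : {measure set (measurableTypeR R) -> \bar R} :=
  mscale (NngNum (ltW r0)) (pushforward mu f).
rewrite -[LHS]/(nu (measurable_affine z r) A).
apply/esym/lebesgue_measure_unique => //= _ [[a b]] _ <-.
rewrite /mscale /= /pushforward.
have -> : f @^-1` [set` `]a, b]]
          = `](a - z) / r, (b - z) / r]%classic.
  apply/seteqP; split=> u /=; rewrite !in_itv/=;
    by rewrite ltr_pdivrMr// ler_pdivlMr// ltrBlDl lerBrDl [u * r]mulrC.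
rewrite !lebesgue_measure_itv/= !lte_fin ltr_pM2r ?invr_gt0// ltrD2r.
case: ifPn => _; last by rewrite mule0.
by rewrite -!EFinD -EFinM; congr EFin; field; rewrite gt_eqF.
Qed.

Lemma uniform_probE (a b : R) (ab : a < b) (A : set R) : measurable A ->
  uniform_prob ab A = ((b - a)^-1%:E * mu (A `&` `[a, b]))%E.
Proof.
move=> mA; rewrite /uniform_prob integral_uniform_pdf.
rewrite (eq_integral (fun=> (b - a)^-1%:E)); last first.
  by move=> x; rewrite inE => -[_]; rewrite /= in_itv/= /uniform_pdf => ->.
by rewrite integral_cst//; exact: measurableI.
Qed.

(** When [U] is uniform on [-1, 1], the point [z + r U] has density 1 / (2 r)
    on an interval that lies inside [I]. *)
Lemma uniform_affine_le (z r : R) (A I : set R) : 0 < r ->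
  measurable A -> measurable I -> `[z - r, z + r] `<=` I ->
  (uniform_prob (ltrN11_num R) ((fun u : R => z + r * u)%R @^-1` A)
   <= (2 * r)^-1%:E * mu (A `&` I))%E.
Proof.
move=> r0 mA mI zrI.
have mpre (B : set R) : measurable B ->
    measurable ((fun u : R => z + r * u)%R @^-1` B).
  move=> mB; rewrite -[X in measurable X]setTI.
  exact: (measurable_affine z r).
rewrite uniform_probE; last exact: mpre.
rewrite -(@lebesgue_measure_affine z r (A `&` I))//; last exact: measurableI.
rewrite muleA -EFinM opprK invfM -mulrA mulVf ?gt_eqF// mulr1.
rewrite lee_pmul2l// ?lte_fin//.
apply: le_measure; rewrite ?inE; [|by apply: mpre; exact: measurableI|].
  by apply: measurableI => //; exact: mpre.
move=> u /= [Au]; rewrite in_itv/= => /andP[u1 u2]; split => //.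
apply: zrI; rewrite /= in_itv/=; nra.
Qed.

End UniformSmoothing.

Section Smoothing.
Context d (Omega : measurableType d) (R : realType) (P : probability Omega R).
Context (I : finType) (X : I -> {RV P >-> R}) (J : {set I}) (s : I).
Hypotheses (indepX : mutually_independent X) (sJ : s \notin J).
Hypothesis X_unif : uniform_on_m1_1 (X s).
Local Notation OmegaJ := (g_sigma_algebraType (cylinder_events X J)).
Variables (Z : OmegaJ -> R) (E : set (OmegaJ * R)) (m rho r p : R).
Hypotheses (mZ : measurable_fun setT Z) (mE : measurable E).
Hypotheses (rho_ge0 : 0 <= rho) (r_gt0 : 0 < r).
Hypothesis E_le : forall th, `|m - th| <= rho + r ->
  (P [set w | E (w, th)] <= p%:E)%E.

(** [Z] and [E] may depend on the same variables [X i], [i \in J], and nothing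
    is assumed on their joint law: integrating out [X s] first bounds the law
    of the centre by a multiple of Lebesgue measure on an interval that does
    not depend on these variables. *)
Lemma uniform_smoothing :
  (P [set w | (`|m - Z w| <= rho)%R /\ E (w, Z w + r * X s w)%R]
   <= ((1 + rho / r) * p)%:E)%E.
Proof.
pose B : set (OmegaJ * R) := [set z | (`|m - Z z.1| <= rho) /\
   E (z.1, Z z.1 + r * z.2)].
pose K : set R := `[m - (rho + r), m + (rho + r)]%classic.
pose E' : set (OmegaJ * R) := E `&` (setT `*` K).
have mK : measurable K by exact: measurable_itv.
have mE' : measurable E' by apply: measurableI => //; exact: measurableX.
have mZ1 : measurable_fun setT (fun z : OmegaJ * R => Z z.1).
  exact: (measurableT_comp mZ).
have mB : measurable B.
  apply: measurableI.
    rewrite -[X in measurable X]setTI; apply: measurable_fun_ler => //.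
    by apply: measurableT_comp => //; exact: measurable_funB.
  rewrite -[X in measurable X]setTI.
  have mshift : measurable_fun setT
      (fun z : OmegaJ * R => (z.1, Z z.1 + r * z.2) : OmegaJ * R).
    apply: measurable_fun_pair; first exact: measurable_fst.
    apply: measurable_funD => //; apply: measurable_funM => //.
  exact: mshift.
have mXB w : measurable (xsection B w) by exact: measurable_xsection.
have mXE w : measurable (xsection E w) by exact: measurable_xsection.
have midJ := measurable_id_sigma (@cylinder_events_measurable _ _ _ P _ X J).
pose idJ : {mfun Omega >-> OmegaJ} := mfun_Sub (mem_set midJ).
have mSec (A : set (OmegaJ * R)) : measurable A ->
    measurable_fun [set: OmegaJ] (fun w => lebesgue_measure (xsection A w)).
  by move=> mA; exact: measurable_fun_xsection.
have -> : [set w | (`|m - Z w| <= rho)%R /\ E (w, Z w + r * X s w)%R]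
    = (fun w => (w, X s w)) @^-1` B by [].
have mpair := measurable_sigma_pair (X s)
  (@cylinder_events_measurable _ _ _ P _ X J).
have mpB : measurable ((fun w : Omega => (w, X s w)) @^-1` B).
  by rewrite -[X in measurable X]setTI; exact: mpair.
have -> : P ((fun w : Omega => (w, X s w)) @^-1` B)
    = (\int[P]_w distribution P (X s) (xsection B w))%E.
  have := integral_cylinder_pair indepX sJ (h := fun z => (\1_B z)%:E).
  move=> /(_ _ _)/= LB.
  transitivity (\int[P]_w (\1_B (w, X s w))%:E)%E.
    transitivity
      (\int[P]_w (\1_((fun w : Omega => (w, X s w)) @^-1` B) w)%:E)%E.
      by rewrite integral_indic// setIT.
    by [].
  rewrite LB; last 2 first.
  - by apply/measurable_EFinP; exact: measurable_indic.
  - by [].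
  apply: eq_integral => w _.
  transitivity (\int[distribution P (X s)]_x (\1_(xsection B w) x)%:E)%E.
    by apply: eq_integral => x _; rewrite !indicE mem_xsection.
  by rewrite integral_indic// setIT.
have XE' w : xsection E' w = xsection E w `&` K.
  by rewrite /E' xsectionI in_xsectionX// inE.
have m2r : measurable_fun setT
    (fun w : Omega => lebesgue_measure (xsection E' w)).
  exact: (measurableT_comp (mSec _ mE') midJ).
(* where Z is close to m, bound the law of the centre by its density *)
apply: (@le_trans _ _
  (\int[P]_w ((2 * r)^-1%:E * lebesgue_measure (xsection E' w)))%E).
  apply: ge0_le_integral => //.
  - have mD : measurable_fun [set: OmegaJ]
        (fun w => distribution P (X s) (xsection B w)).
      exact: measurable_fun_xsection.
    exact: (measurableT_comp mD midJ).
  - exact: measurable_funeM.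
  - move=> w _; have [Zw|Zw] := leP `|m - Z w| rho; last first.
      rewrite [xsection B w](_ : _ = set0) ?measure0.
        by rewrite mule_ge0// lee_fin invr_ge0 mulr_ge0// ltW.
      apply/seteqP; split=> // u; rewrite /xsection/= inE => -[/=].
      by rewrite leNgt Zw.
    rewrite X_unif// XE'.
    rewrite [xsection B w](_ : _ =
      (fun u : R => Z w + r * u)%R @^-1` xsection E w).
      apply: uniform_affine_le => // th; rewrite /K /= !in_itv/=.
      by move: Zw; rewrite ler_norml; lra.
    apply/seteqP; split=> u; rewrite /xsection/= !inE; first by case.
    by move=> Eu; split.
rewrite ge0_integralZl//; last by rewrite lee_fin invr_ge0 mulr_ge0// ltW.
rewrite -(ge0_integral_distribution idJ (mSec _ mE'))//.
(* Tonelli: the centre is now integrated last, with the sample inside *)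
have -> : (\int[distribution P idJ]_w lebesgue_measure (xsection E' w)
    = \int[lebesgue_measure]_th distribution P idJ (ysection E' th))%E.
  have := indic_fubini_tonelli (distribution P idJ) (@lebesgue_measure R) mE'.
  by rewrite indic_fubini_tonelli_FE// indic_fubini_tonelli_GE.
apply: (@le_trans _ _
  ((2 * r)^-1%:E * (p%:E * (2 * (rho + r))%:E))%E); last first.
  rewrite -!EFinM lee_fin le_eqVlt; apply/orP; left; apply/eqP.
  by field; rewrite gt_eqF.
rewrite lee_pmul2l ?lte_fin ?invr_gt0 ?mulr_gt0//.
have p0 : 0 <= p.
  rewrite -lee_fin; apply: le_trans (E_le (th := m) _) => //.
  by rewrite subrr normr0 addr_ge0// ltW.
have -> : ((2 * (rho + r))%:E = lebesgue_measure K :> \bar R)%E.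
  rewrite /K lebesgue_measure_itv/= lte_fin ifT.
    by rewrite -EFinD; congr EFin; ring.
  by rewrite ltrD2l gtrN// ltr_wpDl.
have -> : (p%:E * lebesgue_measure K
    = \int[lebesgue_measure]_th (p%:E * (\1_K th)%:E))%E.
  rewrite ge0_integralZl ?integral_indic ?setIT//.
  by apply/measurable_EFinP; exact: measurable_indic.
apply: ge0_le_integral => //.
- exact: measurable_fun_ysection.
- by apply: measurable_funeM; apply/measurable_EFinP; exact: measurable_indic.
move=> th _; rewrite /distribution /pushforward /=.
have [thK|thK] := pselect (K th).
  rewrite indicE mem_set// mule1.
  rewrite [X in P X](_ : _ = [set w | E (w, th)]).
    by apply: E_le; move: thK; rewrite /K /= in_itv/= ler_norml; lra.
  by apply/seteqP; split=> w; rewrite /ysection/= inE; [case|split].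
rewrite indicE memNset// mule0 [X in P X](_ : _ = set0) ?measure0//.
by apply/seteqP; split=> // w; rewrite /ysection/= inE => -[_ []].
Qed.

End Smoothing.

(** * The iteration *)

Lemma mutually_independent_comp d (Omega : measurableType d) (R : realType)
    (P : probability Omega R) (I I' : finType) (X : I -> {RV P >-> R})
    (g : I' -> I) : injective g ->
  mutually_independent X -> mutually_independent (fun i => X (g i)).
Proof.
move=> g_inj indepX J B mB.
pose B' i := if [pick i' | g i' == i] is Some i' then B i' else setT.
have B'g i : B' (g i) = B i.
  rewrite /B'; case: pickP => [i' /eqP/g_inj ->//|/(_ i)].
  by rewrite eqxx.
have mB' i : i \in (g @: J)%SET -> measurable (B' i).
  by move=> /imsetP[j jJ ->]; rewrite B'g; exact: mB.
have := indepX _ _ mB'; rewrite big_imset/=; last by move=> ? ? _ _ /g_inj.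
under eq_bigr do rewrite B'g.
move=> <-; congr (P _); apply/seteqP; split=> w /= Bw i.
  by move=> /imsetP[j jJ ->]; rewrite B'g; exact: Bw.
by move=> iJ; rewrite -B'g; apply: Bw; exact: imset_f.
Qed.

Section Radii.
Context {R : realType}.
Variables (n : nat) (v0 delta0 : R) (x eps : nat -> R) (k : nat).
Hypotheses (n_gt0 : (0 < n)%N) (v0_gt0 : 0 < v0).
Hypothesis x_gt0 : forall i, (2 <= i <= k)%N -> 0 < x i.
Hypothesis eps_01 : forall i, (1 <= i <= k)%N -> 0 < eps i < 1.

Lemma ln_inv_eps_gt0 i : (1 <= i <= k)%N -> 0 < ln (eps i)^-1.
Proof. by move=> /eps_01 /andP[e0 e1]; rewrite ln_gt0// invf_gt1. Qed.

Lemma expR_ln_inv_eps i : (1 <= i <= k)%N -> expR (- ln (eps i)^-1) = eps i.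
Proof.
by move=> /eps_01 /andP[e0 e1]; rewrite lnV ?posrE// opprK lnK// posrE.
Qed.

Lemma gamma_gt0 i : (2 <= i <= k)%N -> 0 < gamma x i.
Proof. by move=> /x_gt0 xi; rewrite ln_gt0// ltrDl invr_gt0. Qed.

(** The term [gamma x i] is what pays for the density ratio [1 + 1 / x i] of
    [uniform_smoothing]. *)
Lemma expR_level i : (2 <= i <= k)%N ->
  (1 + (x i)^-1) * (2 * expR (- (ln (eps i)^-1 + gamma x i))) = 2 * eps i.
Proof.
move=> ik; have xi := x_gt0 ik.
have ik1 : (1 <= i <= k)%N by case/andP: ik => i2 ->; rewrite andbT ltnW.
rewrite opprD expRD expR_ln_inv_eps// expRN /gamma lnK; last first.
  by rewrite posrE addr_gt0// invr_gt0.
rewrite mulrCA; congr (_ * _); rewrite mulrCA divff ?mulr1//.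
by rewrite gt_eqF// addr_gt0// invr_gt0.
Qed.

Lemma delta_gt0 i : (1 <= i <= k)%N -> 0 < delta n v0 delta0 x eps i.
Proof.
have n0 : (0 : R) < n%:R by rewrite ltr0n.
case: i => [//|[|i]] ik; rewrite /= sqrtr_gt0.
  apply: divr_gt0 => //; apply: mulr_gt0; last exact: ln_inv_eps_gt0.
  by apply: mulr_gt0 => //; rewrite ltr_pwDl// sqr_ge0.
apply: divr_gt0 => //; apply: mulr_gt0; last first.
  by apply: addr_gt0; [exact: ln_inv_eps_gt0|exact: gamma_gt0].
by apply: mulr_gt0 => //; rewrite ltr_pwDl// mulr_ge0// sqr_ge0.
Qed.

End Radii.

Theorem proposition2p1 (d : measure_display) (Omega : measurableType d)
    (R : realType) (P : probability Omega R)
    (n : nat) (n_gt0 : (0 < n)%N) (Y : 'I_n -> {RV P >-> R})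
    (m v : R)
    (Y_id : identically_distributed Y)
    (Y_L2 : forall i, (Y i : Omega -> R) \in Lfun P 2%:E)
    (Y_mean : forall i, ('E_P[Y i] = m%:E)%E)
    (Y_var : forall i, ('V_P[Y i] = v%:E)%E)
    (v0 theta0 delta0 : R) (v0_gt0 : 0 < v0) (delta0_ge0 : 0 <= delta0)
    (v_le : v <= v0) (m_near : `|m - theta0| <= delta0)
    (k : nat) (k_ge1 : (1 <= k)%N) (x eps : nat -> R)
    (x_gt0 : forall i, (2 <= i <= k)%N -> 0 < x i)
    (eps_01 : forall i, (1 <= i <= k)%N -> 0 < eps i < 1)
    (U : nat -> {RV P >-> R})
    (U_unif : forall i, (2 <= i <= k)%N -> uniform_on_m1_1 (U i))
    (indep : mutually_independent (sample_and_noise (k := k) Y U)) :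
  ((1 - 2 * \sum_(1 <= i < k.+1) eps i)%:E <=
   P [set w | (`|m - theta_iter v0 theta0 delta0 x eps
                       (fun i => Y i w) (fun i => U i w) k|
               <= delta n v0 delta0 x eps k)%R])%E.
Proof.
pose X := sample_and_noise (k := k) Y U.
have indepY : mutually_independent Y.
  exact: (mutually_independent_comp inl_inj indep).
pose th i (w : Omega) :=
  theta_iter v0 theta0 delta0 x eps (fun i => Y i w) (fun i => U i w) i.
pose dl := delta n v0 delta0 x eps.
pose bad i := [set w | dl i < `|m - th i w|].
have mth i : measurable_fun setT (th i).
  exact: (measurable_theta_iter _ _ _ _ _ (y := Y) (u := U)).
have mdist i : measurable_fun setT (fun w => `|m - th i w|).
  by apply: measurableT_comp => //; exact: measurable_funB.
have mbad i : measurable (bad i).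
  by rewrite -[X in measurable X]setTI; exact: measurable_fun_ltr.
suff P_bad i : (1 <= i <= k)%N ->
    (P (bad i) <= (2 * \sum_(1 <= j < i.+1) eps j)%:E)%E.
  rewrite [X in (_ <= P X)%E](_ : _ = ~` bad k); last first.
    by apply/seteqP; split=> w /=; rewrite /bad /= leNgt => /negP.
  rewrite probability_setC// EFinB; apply: leeB => //.
  by apply: P_bad; rewrite k_ge1 leqnn.
elim: i => [//|[|j] IHj] jk.
  rewrite big_nat1 -(expR_ln_inv_eps eps_01 jk).
  exact: (estimator_deviation indepY Y_L2 Y_mean Y_var n_gt0 v_le v0_gt0
            (ln_inv_eps_gt0 eps_01 jk) m_near).
have j1k : (1 <= j.+1 <= k)%N by case/andP: jk => _ /ltnW.
have jk1 : (2 <= j.+2 <= k)%N by case/andP: jk.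
have jk2 : (j < k.-1)%N by rewrite -ltnS (ltn_predK k_ge1); case/andP: jk.
have {}IHj := IHj j1k.
(* s is the index of the noise U_(j + 2), and J that of everything else *)
pose s : 'I_n + 'I_k.-1 := inr (Ordinal jk2).
pose J := (~: [set s])%SET.
have sJ : s \notin J by rewrite !inE eqxx.
have rho0 : 0 < dl j.+1 by exact: (delta_gt0 _ n_gt0 v0_gt0 x_gt0 eps_01 j1k).
have xj := x_gt0 _ jk1.
pose OmegaJ := g_sigma_algebraType (cylinder_events X J).
have mY i : measurable_fun setT (Y i : OmegaJ -> R).
  by apply: (measurable_cylinder (X := X) (i := inl i)); rewrite !inE.
have mZ : measurable_fun setT (th j.+1 : OmegaJ -> R).
  apply: measurable_theta_iter => // -[|[|l]] // /andP[_ lj].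
  have lk : (l < k.-1)%N by apply: leq_trans (ltnW jk2).
  apply: (measurable_cylinder (X := X) (i := inr (Ordinal lk))).
  rewrite !inE; apply/eqP => -[lj']; by rewrite lj' ltnn in lj.
pose E : set (OmegaJ * R) := [set z | dl j.+2 <
  `|m - thresholded_estimator (Y ^~ z.1) (alpha n v0 delta0 x eps j.+2) z.2| ].
have mE : measurable E.
  rewrite -[X in measurable X]setTI; apply: measurable_fun_ltr => //.
  apply: measurableT_comp => //; apply: measurable_funB => //.
  apply: (measurable_thresholded_estimator
    (y := fun i (z : OmegaJ * R) => Y i z.1)) => // i.
  exact: (measurableT_comp (mY i)).
pose L := ln (eps j.+2)^-1 + gamma x j.+2.
have L0 : 0 < L.
  by rewrite addr_gt0// ?(ln_inv_eps_gt0 eps_01 jk) ?(gamma_gt0 x_gt0 jk1).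
have E_le c : `|m - c| <= dl j.+1 + x j.+2 * dl j.+1 ->
    (P [set w | E (w, c)] <= (2 * expR (- L))%:E)%E.
  move=> cm; have mc : `|m - c| <= (1 + x j.+2) * dl j.+1.
    by rewrite mulrDl mul1r.
  have := estimator_deviation indepY Y_L2 Y_mean Y_var n_gt0 v_le v0_gt0 L0 mc.
  by rewrite exprMn.
have r0 : 0 < x j.+2 * dl j.+1 by exact: mulr_gt0.
have := uniform_smoothing indep sJ (U_unif _ jk1) mZ mE (ltW rho0) r0 E_le.
rewrite (_ : dl j.+1 / _ = (x j.+2)^-1); last by field; rewrite !gt_eqF.
rewrite (expR_level x_gt0 eps_01 jk1) => new_bad.
(* a bad step j + 2 follows a bad step j + 1 or is a new failure *)
pose good_bad := [set w | `|m - th j.+1 w| <= dl j.+1 /\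
  E (w, th j.+1 w + x j.+2 * dl j.+1 * X s w)].
have mgb : measurable good_bad.
  rewrite (_ : good_bad = ~` bad j.+1 `&` bad j.+2).
    by apply: measurableI => //; exact: measurableC.
  apply/seteqP; rewrite /good_bad /bad; split=> w /= [].
    by rewrite leNgt => /negP.
  by move=> /negP; rewrite -leNgt.
rewrite big_nat_recr//= mulrDr EFinD.
apply: le_trans (leeD IHj new_bad).
apply: le_trans (measureU2 _ (mbad _) mgb).
apply: le_measure; rewrite ?inE//; first exact: measurableU.
by move=> w bw; have [gw|gw] := ltP (dl j.+1) `|m - th j.+1 w|; [left|right].
Qed.
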